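(* Let $G\neq\{e\}$ be a finite group, let $Z$ be a $G$-set and let $M_{\mathfrak n}$ be a UHF-algebra of infinite type. Then the Bernoulli shift of $G$ on $M_{\mathfrak n}^{\otimes Z}$ does not have the Rokhlin property.
   Context: A supernatural number is a formal product $\mathfrak n=\prod_p p^{n_p}$ over all primes $p$ with $n_p\in\{0,1,\dots,\infty\}$. The associated UHF-algebra is $M_{\mathfrak n}=\bigotimes_p M_{p^{n_p}}$ (infinite tensor product over all primes), where $M_k$ is the algebra of $k\times k$ complex matrices for $k<\infty$ and $M_{p^\infty}=M_p^{\otimes\mathbb{N}}$. It is of infinite type if $n_p\in\{0,\infty\}$ for all $p$. For a unital $C^*$-algebra $A$ and a set $Z$, $A^{\otimes Z}=\varinjlim_F A^{\otimes F}$ over the finite subsets $F\subset Z$, with connecting maps $a\mapsto a\otimes 1$. If $Z$ is a $G$-set, the Bernoulli shift on $A^{\otimes Z}$ is the $G$-action permuting the tensor factors according to the $G$-action on $Z$. An action $\alpha$ of a finite group $G$ on a unital $C^*$-algebra $A$ has the Rokhlin property if for every finite set $S\subset A$ and every $\varepsilon>0$ there are mutually orthogonal projections $(e_g)_{g\in G}$ in $A$ with $\sum_{g\in G}e_g=1$, $\|\alpha_g(e_h)-e_{gh}\|<\varepsilon$ for all $g,h\in G$, and $\|e_g a-a e_g\|<\varepsilon$ for all $g\in G$ and $a\in S$. *)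

(* Defs.v *)
From HB Require Import structures.
From mathcomp Require Import all_boot all_order all_algebra all_fingroup.
From mathcomp Require Import finmap.
From mathcomp Require Import all_classical all_reals all_analysis.
From mathcomp Require Import complex.

Set Implicit Arguments.
Unset Strict Implicit.
Unset Printing Implicit Defensive.

Import Order.TTheory GRing.Theory Num.Theory.
Import numFieldNormedType.Exports.

Local Open Scope classical_set_scope.
Local Open Scope complex_scope.
Local Open Scope ring_scope.

(* Unital C*-algebras; zero algebras are excluded, as in [algType]. Norms take
   their values in the nonnegative reals of R[i].
   The multiplication is a separate operation because HB admits no structure
   joining [GRing.PzRing] with a norm below [numDomainType]; the instances
   below give every C*-algebra its ring and algebra notations and theory. *)
Record cstarAlgType (R : realType) := CStarAlgebra {
  cstar_space : completeNormedModType R[i] ;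
  cstar_one : cstar_space ;
  cstar_mul : cstar_space -> cstar_space -> cstar_space ;
  cstar_star : cstar_space -> cstar_space ;
  cstar_mulA : associative cstar_mul ;
  cstar_mul1l : left_id cstar_one cstar_mul ;
  cstar_mul1r : right_id cstar_one cstar_mul ;
  cstar_mulDl : left_distributive cstar_mul +%R ;
  cstar_mulDr : right_distributive cstar_mul +%R ;
  cstar_scaleAl : forall (c : R[i]) a b,
    c *: cstar_mul a b = cstar_mul (c *: a) b ;
  cstar_scaleAr : forall (c : R[i]) a b,
    c *: cstar_mul a b = cstar_mul a (c *: b) ;
  cstar_one_neq0 : cstar_one != 0 ;
  cstar_starK : involutive cstar_star ;
  cstar_starD : {morph cstar_star : a b / a + b} ;
  cstar_starZ : forall (c : R[i]) a,
    cstar_star (c *: a) = (c^*)%R *: cstar_star a ;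
  cstar_starM : forall a b,
    cstar_star (cstar_mul a b) = cstar_mul (cstar_star b) (cstar_star a) ;
  cstar_normM : forall a b, `|cstar_mul a b| <= `|a| * `|b| ;
  cstar_identity : forall a, `|cstar_mul (cstar_star a) a| = `|a| ^+ 2
}.

Definition cstar_sort (R : realType) (A : cstarAlgType R) : Type := cstar_space A.
Coercion cstar_sort : cstarAlgType >-> Sortclass.

HB.instance Definition _ (R : realType) (A : cstarAlgType R) :=
  CompleteNormedModule.on (cstar_sort A).
HB.instance Definition _ (R : realType) (A : cstarAlgType R) :=
  GRing.Zmodule_isNzRing.Build (cstar_sort A)
    (@cstar_mulA R A) (@cstar_mul1l R A) (@cstar_mul1r R A)
    (@cstar_mulDl R A) (@cstar_mulDr R A) (@cstar_one_neq0 R A).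
HB.instance Definition _ (R : realType) (A : cstarAlgType R) :=
  GRing.Lmodule_isLalgebra.Build R[i] (cstar_sort A) (@cstar_scaleAl R A).
HB.instance Definition _ (R : realType) (A : cstarAlgType R) :=
  GRing.Lalgebra_isAlgebra.Build R[i] (cstar_sort A) (@cstar_scaleAr R A).

Definition star (R : realType) (A : cstarAlgType R) : A -> A := @cstar_star R A.

Definition star_hom (R : realType) (A B : cstarAlgType R) (f : A -> B) : Prop :=
  [/\ linear f, monoid_morphism f & forall a, f (star a) = star (f a)].

Definition is_state (R : realType) (A : cstarAlgType R) (phi : {scalar A}) : Prop :=
  phi 1 = 1 /\ forall a : A, 0 <= phi (star a * a).

Section FiniteTensor.
Variables (R : realType) (J : finType) (A : J -> cstarAlgType R).

(* Representatives of elements of the algebraic tensor product of the A j: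
   the list of the (c_k, a_k) stands for \sum_k c_k (\bigotimes_j a_k j).
   The coefficients matter when J is empty. *)
Definition formal_tensor : Type := seq (R[i] * (forall j, A j)).

Definition ft_mul (s t : formal_tensor) : formal_tensor :=
  [seq (u.1 * v.1, fun j => u.2 j * v.2 j) | u <- s, v <- t].

Definition ft_star (s : formal_tensor) : formal_tensor :=
  [seq ((u.1^*)%R, fun j => star (u.2 j)) | u <- s].

Definition ft_state (phi : forall j, {scalar (A j)}) (s : formal_tensor) : R[i] :=
  \sum_(u <- s) u.1 * \prod_j phi j (u.2 j).

(* The factors of the product commute in the situation of [is_fin_tensor],
   so their order is irrelevant. *)
Definition ft_eval (T : cstarAlgType R) (iota : forall j, A j -> T)
    (s : formal_tensor) : T :=
  \sum_(u <- s) u.1 *: \prod_j iota j (u.2 j).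

(* B bounds the minimal (spatial) norm of s, i.e. the norm of s in the tensor
   product of the universal representations of the A j. Those are the direct
   sums of the GNS representations of states, and the GNS space of a product
   state Phi is densely spanned by the classes of formal tensors t, with
   |t|^2 = Phi(t^* t) and |s t|^2 = Phi(t^* s^* s t). *)
Definition spatial_norm_le (s : formal_tensor) (B : R) : Prop :=
  forall phi : (forall j, {scalar (A j)}), (forall j, is_state (phi j)) ->
  forall t : formal_tensor,
    ft_state phi (ft_mul (ft_star t) (ft_mul (ft_star s) (ft_mul s t)))
      <= (B ^+ 2)%:C * ft_state phi (ft_mul (ft_star t) t).

(* T, together with the maps iota j : a |-> 1 (x) .. a .. (x) 1, is the
   completion of the algebraic tensor product of the A j in the spatial norm. *)
Definition is_fin_tensor (T : cstarAlgType R) (iota : forall j, A j -> T) : Prop :=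
  [/\ forall j, star_hom (iota j),
      forall j k (a : A j) (b : A k), j != k ->
        iota j a * iota k b = iota k b * iota j a,
      forall (s : formal_tensor) (B : R), 0 <= B ->
        (`|ft_eval iota s| <= B%:C <-> spatial_norm_le s B)
    & dense (range (ft_eval iota))].

End FiniteTensor.

Section InductiveLimit.
Variables (R : realType) (J : Type) (le : J -> J -> Prop).
Variables (A : J -> cstarAlgType R) (kappa : forall i j, le i j -> A i -> A j).

Definition is_inductive_system : Prop :=
  [/\ forall i j (h : le i j), star_hom (kappa h),
      forall i (h : le i i) a, kappa h a = a
    & forall i j k (hij : le i j) (hjk : le j k) (hik : le i k) a,
        kappa hjk (kappa hij a) = kappa hik a].

(* T is the completion of the algebraic direct limit for the seminorm
   |[a]| = lim_j |kappa_ij a|, a in A i. *)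
Definition is_inductive_limit (T : cstarAlgType R) (lambda : forall j, A j -> T) : Prop :=
  [/\ forall j, star_hom (lambda j),
      forall i j (h : le i j) a, lambda j (kappa h a) = lambda i a,
      forall i (a : A i) (eps : R), 0 < eps ->
        exists2 j0, le i j0 & forall j (h : le i j), le j0 j ->
          `| `|kappa h a| - `|lambda i a| | < eps%:C
    & dense (\bigcup_j range (lambda j))].

End InductiveLimit.

(* The inductive limit of the finite tensor products of (A i)_(i in F) over
   the finite subsets F of I, along the maps a |-> a (x) 1; [iota i] is the
   inclusion of the i-th tensor factor. *)
Definition is_tensor (R : realType) (I : choiceType) (A : I -> cstarAlgType R)
    (T : cstarAlgType R) (iota : forall i, A i -> T) : Prop :=
  exists (TF : {fset I} -> cstarAlgType R)
         (iotaF : forall (F : {fset I}) (i : F), A (val i) -> TF F)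
         (kappa : forall F F' : {fset I}, (F `<=` F')%fset -> TF F -> TF F')
         (lambda : forall F : {fset I}, TF F -> T),
    [/\ forall F : {fset I}, is_fin_tensor (@iotaF F),
        is_inductive_system kappa,
        forall (F F' : {fset I}) (h : (F `<=` F')%fset) (i : I)
            (iF : i \in F) (iF' : i \in F') (a : A i),
          kappa F F' h (iotaF F [` iF]%fset a) = iotaF F' [` iF']%fset a,
        is_inductive_limit kappa lambda
      & forall (F : {fset I}) (i : I) (iF : i \in F) (a : A i),
          lambda F (iotaF F [` iF]%fset a) = iota i a].

Definition is_tensor_power (R : realType) (Z : choiceType) (A T : cstarAlgType R)
    (iota : Z -> A -> T) : Prop :=
  is_tensor (A := fun _ : Z => A) iota.

(* A is the algebra of k x k complex matrices; its C*-norm is unique. *)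
Definition is_matrix_algebra (R : realType) (k : nat) (A : cstarAlgType R) : Prop :=
  exists f : 'M[R[i]]_k -> A,
    [/\ bijective f, linear f, monoid_morphism f
      & forall m, f (map_mx Num.conj m^T) = star (f m)].

Definition prime_number : choiceType := {p : nat | prime p}.

(* Exponents; None stands for infinity. *)
Definition supernatural : Type := prime_number -> option nat.

Definition infinite_type (n : supernatural) : Prop :=
  forall p, n p = Some 0%N \/ n p = None.

Definition is_matrix_prime_power (R : realType) (p : nat) (e : option nat)
    (A : cstarAlgType R) : Prop :=
  match e with
  | Some k => is_matrix_algebra (p ^ k)%N A
  | None => exists (D : cstarAlgType R) (iota : nat -> D -> A),
      is_matrix_algebra p D /\ is_tensor_power iota
  end.

Definition is_UHF (R : realType) (n : supernatural) (A : cstarAlgType R) : Prop :=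
  exists (B : prime_number -> cstarAlgType R) (iota : forall p, B p -> A),
    (forall p, is_matrix_prime_power (val p) (n p) (B p)) /\ is_tensor iota.

(* Left actions, unlike the right actions of fingroup.action. *)
Definition is_left_action (G : finGroupType) (Z : Type) (act : G -> Z -> Z) : Prop :=
  (forall z, act 1%g z = z) /\
  (forall g h z, act (g * h)%g z = act g (act h z)).

Definition is_cstar_action (R : realType) (G : finGroupType) (A : cstarAlgType R)
    (alpha : G -> A -> A) : Prop :=
  is_left_action alpha /\ forall g, star_hom (alpha g).

(* By density of the subalgebra generated by the tensor factors, there is only
   one such alpha. *)
Definition is_bernoulli_shift (R : realType) (G : finGroupType) (Z : choiceType)
    (act : G -> Z -> Z) (A T : cstarAlgType R) (iota : Z -> A -> T)
    (alpha : G -> T -> T) : Prop :=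
  is_cstar_action alpha /\
  forall g z a, alpha g (iota z a) = iota (act g z) a.

Definition is_projection (R : realType) (A : cstarAlgType R) (e : A) : Prop :=
  star e = e /\ e * e = e.

Definition rokhlin_property (R : realType) (G : finGroupType) (A : cstarAlgType R)
    (alpha : G -> A -> A) : Prop :=
  forall (S : set A) (eps : R), finite_set S -> 0 < eps ->
  exists e : G -> A,
    [/\ (forall g, is_projection (e g)) /\
          (forall g h, g != h -> e g * e h = 0),
        \sum_(g : G) e g = 1,
        forall g h, `|alpha g (e h) - e (g * h)%g| < eps%:C
      & forall g a, S a -> `|e g * a - a * e g| < eps%:C].

(* Main.v *)
Require Import Defs.
From HB Require Import structures.
From mathcomp Require Import all_boot all_order all_algebra all_fingroup.
From mathcomp Require Import cyclic finmap.
From mathcomp Require Import all_classical all_reals all_analysis.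
From mathcomp Require Import complex.

Set Implicit Arguments.
Unset Strict Implicit.
Unset Printing Implicit Defensive.

Import Order.TTheory GRing.Theory Num.Theory.
Import numFieldNormedType.Exports.

Local Open Scope classical_set_scope.
Local Open Scope complex_scope.
Local Open Scope ring_scope.

(** The obstruction is the trace of a permutation matrix. Fix g <> 1 of order q
    and a complex number omega <> 1 with omega^q = 1. Weighting the Rokhlin
    projections e_h by powers of omega, with weights that are multiplied by
    omega when h is replaced by g h, gives a unitary v with alpha_g(v) close to
    omega^-1 v ([rokhlin_unitary]). By density v is close to an element u of
    a subalgebra generated by finitely many matrix algebras iota_z(phi_j(M_k)),
    where the finite set of points z may be taken invariant under G
    ([finite_stage_dense]). The average b of omega^i alpha_g^i(u) over i < q
    lies in the same subalgebra, is still close to v, hence is invertible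
    ([invertible_near_unitary]), and is an exact eigenvector:
    alpha_g(b) = omega^-1 b.

    This is impossible. The subalgebra is spanned by matrix units E_ab whose
    indices a are the functions on the finite set of points, and alpha_g sends
    E_ab to E_(s a)(s b), where the permutation s moves such a function along
    the action. So u b = alpha_g(b) u = omega^-1 b u for the permutation
    matrix u of s, and u and omega^-1 u are conjugate by b, so that
    the trace of u is 0. But this trace counts the fixed points of s, and the
    constant functions are fixed ([eigenvector_fixed_count],
    [finite_stage_eigenvalue]). The exactness of the eigenvalue equation
    matters: the normalized trace of u may tend to 0 along the finite stages.

    The trace is computed from the matrix unit relations alone, so it makes sense
    for any commuting matrix algebras, and the tensor products enter only through
    the density of their finite stages. For iterated tensor products that density
    rests on the continuity of *-homomorphisms f. If a is selfadjoint of norm at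
    most 1/2, completeness gives a selfadjoint y commuting with a with y^2 = 1 - a^2;
    then f(a) is the real part of the unitary f(a) + i f(y), so its norm is at
    most 1 ([star_hom_selfadjoint_bounded]). *)

(** * Fixed points of contractions *)

Lemma complex_norm_bounded (R : realType) (x : R[i]) : exists n, `|x| < n%:R.
Proof.
exists (Num.truncn (complex.Re `|x|)).+1.
have -> : `|x| = (complex.Re `|x|)%:C by rewrite RRe_real // ger0_real.
by rewrite -(rmorph_nat (real_complex R)) ltcR truncnS_gt.
Qed.

Lemma half_expn_small (R : realType) (c e : R[i]) :
  0 < e -> exists n, 2^-1 ^+ n * `|c| < e.
Proof.
move=> e0; have [n] := complex_norm_bounded (c / e).
rewrite normrM normfV (gtr0_norm e0) ltr_pdivrMr // => nc.
exists n; rewrite exprVn mulrC ltr_pdivrMr ?exprn_gt0 //.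
apply: lt_le_trans nc _; rewrite mulrC ler_pM2l // -natrX ler_nat.
exact/ltnW/ltn_expl.
Qed.

(** Closedness in terms of norms, which here take their values in R[i]. *)
Definition norm_closed (K : numFieldType) (V : normedZmodType K)
    (P : V -> Prop) : Prop :=
  forall x, (forall e : K, 0 < e -> exists2 y, P y & `|x - y| < e) -> P x.

(** Banach's theorem for norms valued in the partially ordered field R[i]. It
    yields square roots and inverses in C*-algebras, where the ratio is 1/2. *)
Lemma half_contraction_fixpoint (R : realType) (V : completeNormedModType R[i])
    (P : V -> Prop) (F : V -> V) (x0 : V) :
  norm_closed P -> P x0 -> (forall x, P x -> P (F x)) ->
  (forall x y, P x -> P y -> `|F x - F y| <= 2^-1 * `|x - y|) ->
  exists2 x, P x & F x = x.
Proof.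
move=> clP P0 PF ctr; pose u n := iter n F x0.
have Pu n : P (u n) by elim: n => //= n; apply: PF.
have half0 : 0 <= 2^-1 :> R[i] by [].
(* Telescoping: the orbit stays in a ball of radius 2 |F x0 - x0| about x0. *)
have bnd m : `|u m - x0| <= 2 * `|F x0 - x0|.
  elim: m => [|m IH]; first by rewrite subrr normr0 mulr_ge0.
  apply: le_trans (ler_distD (F x0) _ _) _; rewrite mulr_natl [leRHS]mulr2n lerD2r.
  by apply: le_trans (ctr _ _ (Pu m) P0) _; rewrite ler_pdivrMl.
have iterP n m : `|u (m + n)%N - u n| <= 2^-1 ^+ n * `|2 *: (F x0 - x0)|.
  elim: n => [|n IH]; first by rewrite addn0 expr0 mul1r normrZ normr_nat.
  rewrite addnS exprS -mulrA; apply: le_trans (ctr _ _ (Pu _) (Pu _)) _.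
  by rewrite ler_wpM2l.
have cu : cauchy (u @ \oo).
  apply: cauchy_exP => e e0; have [n] := half_expn_small `|2 *: (F x0 - x0)| e0.
  rewrite normr_id => ne; exists (u n); exists n => // m /= nm.
  rewrite -ball_normE /= distrC -(subnK nm).
  exact: le_lt_trans ne.
have /cauchy_cvg /cvg_ex[/= x ux] := cu.
have uxP e : 0 < e -> exists n, forall m, (n <= m)%N -> `|x - u m| < e.
  by move=> e0; move/cvgrPdist_lt: ux => /(_ e e0) [n _ nP]; exists n.
have Px : P x.
  by apply: clP => e e0; have [n nP] := uxP e e0; exists (u n) => //; apply: nP.
exists x => //; apply/eqP; rewrite -subr_eq0; apply: contraT => Fx_neq.
have d0 : 0 < 2^-1 * `|F x - x| by rewrite mulr_gt0 ?normr_gt0 // invr_gt0.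
have [n nP] := uxP _ d0.
suff : `|F x - x| < `|F x - x| by rewrite ltxx.
apply: le_lt_trans (ler_distD (u n.+1) _ _) _.
rewrite [ltRHS](splitr `|F x - x|) [_ / 2]mulrC ler_ltD //; last by rewrite distrC nP.
apply: le_trans (ctr _ _ Px (Pu n)) _.
apply: le_trans (ler_piMl _ _) (ltW (nP n (leqnn n))) => //.
by rewrite invf_le1 // ler1n.
Qed.

(** * Square roots in C*-algebras and continuity of *-homomorphisms *)

Lemma norm_closed_zero (K : numFieldType) (V W : normedZmodType K)
    (h : V -> W) (c : K) :
  (forall x y, `|h x - h y| <= c * `|x - y|) -> norm_closed (fun x => h x = 0).
Proof.
move=> hc x clx; apply/eqP; apply: contraT => hx.
have hx0 : 0 < `|h x| by rewrite normr_gt0.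
have c1 : 0 < `|c| + 1 by rewrite ltr_wpDl.
have [y hy /ltW xy] := clx _ (divr_gt0 hx0 c1).
have cle : c * `|x - y| <= `|c| * `|x - y|.
  have := le_trans (normr_ge0 _) (hc x y); have [->|] := eqVneq `|x - y| 0; first by rewrite !mulr0.
  move=> xy0 c0; rewrite ler_wpM2r //.
  by rewrite -[c](mulfK xy0) normrM normfV normr_id ger0_norm.
have := le_trans (hc x y) (le_trans cle (ler_wpM2l (normr_ge0 _) xy)).
rewrite hy subr0 mulrCA -[leLHS]mulr1 ler_pM2l // ler_pdivlMr // mul1r.
by rewrite gerDl ler10.
Qed.

Lemma norm_closed_le (K : numFieldType) (V : normedZmodType K) (r : K) :
  r \is Num.real -> norm_closed (fun x : V => `|x| <= r).
Proof.
move=> rr x clx; have [//|] := real_leP (normr_real x) rr; rewrite -subr_gt0 => rx.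
have [y yr xy] := clx _ rx.
suff : `|x| < `|x| by rewrite ltxx.
have := ltr_leD xy yr; rewrite subrK; apply: le_lt_trans.
by have := ler_normD (x - y) y; rewrite subrK.
Qed.

Section CStarAlgebra.
Variables (R : realType) (A : cstarAlgType R).
Implicit Types a b x y : A.

Lemma starK : involutive (@star R A). Proof. exact: cstar_starK. Qed.
Lemma starD a b : star (a + b) = star a + star b. Proof. exact: cstar_starD. Qed.
Lemma starZ (c : R[i]) a : star (c *: a) = (c^*)%R *: star a.
Proof. exact: cstar_starZ. Qed.
Lemma starM a b : star (a * b) = star b * star a. Proof. exact: cstar_starM. Qed.
Lemma cnormM a b : `|a * b| <= `|a| * `|b|. Proof. exact: cstar_normM. Qed.
Lemma cnorm_starM a : `|star a * a| = `|a| ^+ 2. Proof. exact: cstar_identity. Qed.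
Lemma star1 : star 1 = 1 :> A.
Proof. by rewrite -[LHS]mulr1 -{2}(starK (1 : A)) -starM mulr1 starK. Qed.
Lemma star0 : star 0 = 0 :> A.
Proof. by rewrite -[0 in LHS](scale0r 0) starZ rmorph0 scale0r. Qed.
Lemma starN a : star (- a) = - star a.
Proof. by rewrite -scaleN1r starZ rmorphN1 scaleN1r. Qed.
Lemma starB a b : star (a - b) = star a - star b.
Proof. by rewrite starD starN. Qed.
Lemma star_sum (I : Type) (s : seq I) (F : I -> A) :
  star (\sum_(i <- s) F i) = \sum_(i <- s) star (F i).
Proof. exact: (big_morph _ starD star0). Qed.

Lemma cnorm_star a : `|star a| = `|a|.
Proof.
suff le x : `|x| <= `|star x| by apply/le_anti; rewrite -{2}(starK a) !le.
have [->|x0] := eqVneq x 0; first by rewrite star0.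
have nx : 0 < `|x| by rewrite normr_gt0.
by rewrite -(ler_pM2r nx) -expr2 -cnorm_starM cnormM.
Qed.

Lemma cnorm_unitary a : star a * a = 1 -> `|a| = 1.
Proof.
have nx : 0 < `|1 : A| by rewrite normr_gt0 oner_neq0.
have n1 : `|1 : A| = 1.
  by apply: (mulfI (lt0r_neq0 nx)); rewrite mulr1 -expr2 -cnorm_starM star1 mulr1.
move=> ua; have := cnorm_starM a; rewrite ua n1 => /esym/eqP.
by rewrite sqrp_eq1 // => /eqP.
Qed.

(** A right inverse w is a fixed point of w |-> 1 + (1 - x) w, and a left inverse
    is found symmetrically; the two then coincide. *)
Lemma invertible_near1 x :
  `|1 - x| <= 2^-1 -> exists2 w, x * w = 1 & w * x = 1.
Proof.
move=> x1.
have [w _ wP] : exists2 w, True & 1 + (1 - x) * w = w.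
  apply: half_contraction_fixpoint (0 : A) _ _ _ _ => // y z _ _.
  rewrite opprD addrACA subrr add0r -mulrBr.
  by apply: le_trans (cnormM _ _) _; rewrite ler_wpM2r.
have [z _ zP] : exists2 z, True & 1 + z * (1 - x) = z.
  apply: half_contraction_fixpoint (0 : A) _ _ _ _ => // y z _ _.
  rewrite opprD addrACA subrr add0r -mulrBl.
  by apply: le_trans (cnormM _ _) _; rewrite mulrC ler_wpM2r.
have xw : x * w = 1.
  move/eqP: wP; rewrite mulrBl mul1r addrCA eq_sym -subr_eq0 opprD addrA.
  by rewrite subrr add0r opprB subr_eq0 => /eqP.
have zx : z * x = 1.
  move/eqP: zP; rewrite mulrBr mulr1 addrCA eq_sym -subr_eq0 opprD addrA.
  by rewrite subrr add0r opprB subr_eq0 => /eqP.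
by exists w => //; rewrite -[w]mul1r -{1}zx -mulrA xw mulr1.
Qed.

(** Writing y = 1 - x, the equation y^2 = 1 - a^2 says that x is a fixed point of
    x |-> (a^2 + x^2) / 2, which is a contraction of the ball of radius 1/2.
    Selfadjointness and commutation with a are closed conditions which the
    iteration preserves. *)
Lemma sqrt_one_minus_square a : star a = a -> `|a| <= 2^-1 ->
  exists y, [/\ star y = y, y * a = a * y & y * y = 1 - a * a].
Proof.
move=> sa na.
pose P x := [/\ star x - x = 0, x * a - a * x = 0 & `|x| <= 2^-1].
have clP : norm_closed P.
  move=> x clx; split.
  - apply: (@norm_closed_zero _ _ _ (fun x => star x - x) 2) => [y z|e /clx[y []]].
      have -> : star y - y - (star z - z) = star (y - z) - (y - z).
        by rewrite starB !opprD addrACA.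
      apply: le_trans (ler_normB _ _) _.
      by rewrite cnorm_star mulr_natl.
    by exists y.
  - apply: (@norm_closed_zero _ _ _ (fun x => x * a - a * x) (2 * `|a|)) => [y z|e /clx[y []]].
      have -> : y * a - a * y - (z * a - a * z) = (y - z) * a - a * (y - z).
        by rewrite mulrBl mulrBr !opprD addrACA.
      apply: le_trans (ler_normB _ _) _; rewrite -mulrA mulr_natl mulr2n lerD ?cnormM //.
      by rewrite mulrC cnormM.
    by exists y.
  - apply: (@norm_closed_le _ A) => [|e /clx[y []]]; first exact: ger0_real.
    by exists y.
have half0 : 0 <= 2^-1 :> R[i] by [].
have [x [/subr0_eq sx /subr0_eq xa _] xE] : exists2 x, P x & 2^-1 *: (a * a + x * x) = x.
  apply: (half_contraction_fixpoint (x0 := 0)) => //.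
  - by split; rewrite ?star0 ?mul0r ?mulr0 ?subrr ?normr0.
  - move=> x [/subr0_eq sx /subr0_eq xa nx]; split.
    + by rewrite starZ starD !starM sa sx fmorphV rmorph_nat subrr.
    + rewrite -scalerAl -scalerAr mulrDl mulrDr !mulrA -(mulrA x x a) xa mulrA xa.
      by rewrite subrr.
    + rewrite normrZ ger0_norm //; apply: ler_piMr => //.
      apply: le_trans (ler_normD _ _) _.
      rewrite (splitr 1) lerD // mul1r; apply: le_trans (cnormM _ _) _.
        by apply: le_trans (ler_pM _ _ na na) _ => //; rewrite ler_piMr // invf_le1 // ler1n.
      by apply: le_trans (ler_pM _ _ nx nx) _ => //; rewrite ler_piMr // invf_le1 // ler1n.
  - move=> x y [_ _ nx] [_ _ ny].
    rewrite -scalerBr opprD addrACA subrr add0r normrZ ger0_norm // ler_wpM2l //.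
    have -> : x * x - y * y = (x - y) * x + y * (x - y).
      by rewrite mulrBl mulrBr addrA subrK.
    apply: le_trans (ler_normD _ _) _.
    rewrite (splitr `|x - y|) lerD //; apply: le_trans (cnormM _ _) _.
      by rewrite ler_wpM2l.
    by rewrite mulrC ler_wpM2l.
exists (1 - x); split.
- by rewrite starB star1 sx.
- by rewrite mulrBl mulrBr xa mul1r mulr1.
- rewrite mulrBl !mulrBr !mul1r mulr1.
  have <- : x + x - x * x = a * a.
    by rewrite -{1 2}xE -scalerDl -[2^-1]mul1r -splitr scale1r addrK.
  by rewrite !(opprD, opprK) !addrA.
Qed.

End CStarAlgebra.

Section StarHom.
Variables (R : realType) (A B : cstarAlgType R) (f : A -> B).
Hypothesis fhom : star_hom f.

Lemma star_homD a b : f (a + b) = f a + f b.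
Proof. by have [fl _ _] := fhom; have := fl 1 a b; rewrite !scale1r. Qed.
Lemma star_hom0 : f 0 = 0.
Proof. by apply/(addrI (f 0)); rewrite -star_homD !addr0. Qed.
Lemma star_homZ (c : R[i]) a : f (c *: a) = c *: f a.
Proof. by have [fl _ _] := fhom; have := fl c a 0; rewrite star_hom0 !addr0. Qed.
Lemma star_homB a b : f (a - b) = f a - f b.
Proof. by rewrite -scaleN1r star_homD star_homZ scaleN1r. Qed.
Lemma star_homM a b : f (a * b) = f a * f b. Proof. by have [_ [_ ->]] := fhom. Qed.
Lemma star_hom1 : f 1 = 1. Proof. by have [_ [-> _]] := fhom. Qed.
Lemma star_hom_star a : f (star a) = star (f a). Proof. by have [_ _ ->] := fhom. Qed.
Lemma star_hom_sum (I : Type) (s : seq I) (F : I -> A) :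
  f (\sum_(i <- s) F i) = \sum_(i <- s) f (F i).
Proof. exact: (big_morph _ star_homD star_hom0). Qed.
Lemma star_hom_prod (I : Type) (s : seq I) (F : I -> A) :
  f (\prod_(i <- s) F i) = \prod_(i <- s) f (F i).
Proof. exact: (big_morph _ star_homM star_hom1). Qed.

(** With y the square root of 1 - a^2, the element w = f a + i f y is unitary and
    f a is its real part. This avoids spectral theory. *)
Lemma star_hom_selfadjoint_bounded a : star a = a -> `|a| <= 2^-1 -> `|f a| <= 1.
Proof.
move=> sa /(sqrt_one_minus_square sa)[y [sy ya yy]].
pose c := f a; pose d := f y.
have sc : star c = c by rewrite /c -star_hom_star sa.
have sd : star d = d by rewrite /d -star_hom_star sy.
have dc : d * c = c * d by rewrite /c /d -!star_homM ya.
have dd : d * d = 1 - c * c by rewrite /c /d -!star_homM yy star_homB star_hom1 star_homM.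
pose w := c + 'i *: d.
have sw : star w = c - 'i *: d by rewrite /w starD starZ sc sd conjCi scaleNr.
have nw : `|w| = 1.
  apply: cnorm_unitary; rewrite sw /w mulrDr !mulrBl.
  rewrite -!scalerAl -!scalerAr dc addrA subrK scalerA -[X in X *: _]expr2 sqrCi scaleN1r dd.
  by rewrite opprK addrC subrK.
have -> : f a = 2^-1 *: (w + star w).
  by rewrite sw /w addrACA subrr addr0 -mulr2n -[c *+ 2]scaler_nat scalerA mulVf // scale1r.
rewrite normrZ ger0_norm // ler_pdivrMl // mulr1 .
by apply: le_trans (ler_normD _ _) _; rewrite cnorm_star nw.
Qed.

(** Scaling star a * a to norm 1/2 and the C*-identity reduce the bound to the
    selfadjoint case. The constant 2 is not optimal, but any constant gives
    continuity. *)
Lemma star_hom_bounded a : `|f a| <= 2 * `|a|.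
Proof.
have [->|a0] := eqVneq a 0; first by rewrite star_hom0 !normr0 mulr0.
have na : 0 < `|a| by rewrite normr_gt0.
have n2 : 0 < 2 * `|a| ^+ 2 by rewrite mulr_gt0 // exprn_gt0.
pose b := (2 * `|a| ^+ 2)^-1 *: (star a * a).
have sb : star b = b.
  by rewrite /b starZ starM starK fmorphV /= (CrealP (ger0_real (ltW n2))).
have nb : `|b| <= 2^-1.
  rewrite /b normrZ cnorm_starM ger0_norm ?invr_ge0 ?(ltW n2) // invfM -mulrA.
  by rewrite mulVf ?mulr1 ?expf_neq0 ?gt_eqF.
have := star_hom_selfadjoint_bounded sb nb.
rewrite star_homZ normrZ star_homM star_hom_star cnorm_starM.
rewrite ger0_norm ?invr_ge0 ?(ltW n2) // ler_pdivrMl // mulr1 => le1.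
rewrite -(@ler_pXn2r _ 2) ?nnegrE ?mulr_ge0 // exprMn; apply: le_trans le1 _.
by rewrite ler_wpM2r ?exprn_ge0 // expr2 -natrM ler_nat.
Qed.

End StarHom.

Lemma star_hom_comp (R : realType) (A1 A2 A3 : cstarAlgType R) (f : A1 -> A2) (g : A2 -> A3) :
  star_hom f -> star_hom g -> star_hom (g \o f).
Proof.
move=> fh gh; split=> [c a b||a] /=.
- by rewrite (star_homD fh) (star_homZ fh) (star_homD gh) (star_homZ gh).
- by split=> [|a b] /=; rewrite ?(star_hom1 fh) ?(star_hom1 gh) // (star_homM fh) (star_homM gh).
- by rewrite (star_hom_star fh) (star_hom_star gh).
Qed.

Lemma eq_star_hom (R : realType) (A1 A2 : cstarAlgType R) (f g : A1 -> A2) :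
  f =1 g -> star_hom f -> star_hom g.
Proof. by move=> /funext ->. Qed.

(** * Generators of tensor products and UHF algebras *)

Definition is_subalgebra (R : realType) (A : cstarAlgType R) (P : A -> Prop) : Prop :=
  [/\ P 1, forall a b, P a -> P b -> P (a + b),
      forall (c : R[i]) a, P a -> P (c *: a)
    & forall a b, P a -> P b -> P (a * b)].

(** Impredicative: a closed subalgebra is exhausted by checking generators,
    which is how density passes through iterated tensor products. *)
Definition generates (R : realType) (A : cstarAlgType R) (S : A -> Prop) : Prop :=
  forall P : A -> Prop, is_subalgebra P -> norm_closed P ->
    (forall a, S a -> P a) -> forall a, P a.

Section Subalgebra.
Variables (R : realType) (A : cstarAlgType R) (P : A -> Prop).
Hypothesis algP : is_subalgebra P.

Lemma subalgebra0 : P 0.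
Proof. by have [P1 _ PZ _] := algP; rewrite -(scale0r (1 : A)); apply: PZ. Qed.

Lemma subalgebra_sum (I : Type) (s : seq I) (Q : pred I) (F : I -> A) :
  (forall i, Q i -> P (F i)) -> P (\sum_(i <- s | Q i) F i).
Proof. by have [_ PD _ _] := algP; exact: (big_ind P subalgebra0 PD). Qed.

Lemma subalgebra_prod (I : Type) (s : seq I) (F : I -> A) :
  (forall i, P (F i)) -> P (\prod_(i <- s) F i).
Proof. by have [P1 _ _ PM] := algP; move=> PF; exact: (big_ind P P1 PM). Qed.

Lemma subalgebra_preim (B : cstarAlgType R) (f : B -> A) :
  star_hom f -> is_subalgebra (fun b => P (f b)).
Proof.
move=> fh; have [P1 PD PZ PM] := algP; split=> [|a b Pa Pb|c a Pa|a b Pa Pb].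
- by rewrite (star_hom1 fh).
- by rewrite (star_homD fh); apply: PD.
- by rewrite (star_homZ fh); apply: PZ.
- by rewrite (star_homM fh); apply: PM.
Qed.

End Subalgebra.

Lemma norm_closed_preim (R : realType) (A B : cstarAlgType R) (f : B -> A)
    (P : A -> Prop) : star_hom f -> norm_closed P -> norm_closed (fun b => P (f b)).
Proof.
move=> fh clP b clb; apply: clP => e e0.
have e2 : 0 < e / 2 by rewrite divr_gt0.
have [b' Pb' bb'] := clb _ e2; exists (f b') => //.
rewrite -(star_homB fh); apply: le_lt_trans (star_hom_bounded fh _) _.
by rewrite mulrC -ltr_pdivlMr.
Qed.

Lemma dense_approx (R : realType) (A : cstarAlgType R) (D : set A) :
  dense D -> forall (x : A) (e : R[i]), 0 < e -> exists2 y, D y & `|x - y| < e.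
Proof.
move=> dD x e e0.
have [|y [xy Dy]] := dD (ball x e) _ (ball_open x e).
  by exists x; apply: ballxx.
by exists y => //; move: xy; rewrite -ball_normE.
Qed.

Lemma fin_tensor_generates (R : realType) (J : finType) (A : J -> cstarAlgType R)
    (T : cstarAlgType R) (iota : forall j, A j -> T) :
  is_fin_tensor iota -> generates (fun x => exists j a, x = iota j a).
Proof.
move=> [_ _ _ dT] P algP clP Piota a; apply: clP => e e0.
have [y [s _ <-] ay] := dense_approx dT a e0; exists (ft_eval iota s) => //.
apply: (subalgebra_sum algP) => u _; have [_ _ PZ _] := algP; apply: PZ.
by apply: (subalgebra_prod algP) => j; apply: Piota; exists j, (u.2 j).
Qed.

Section Tensor.
Variables (R : realType) (I : choiceType) (A : I -> cstarAlgType R).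
Variables (T : cstarAlgType R) (iota : forall i, A i -> T).
Hypothesis Ttensor : is_tensor iota.

Lemma tensor_star_hom i : star_hom (@iota i).
Proof.
have [TF [iotaF [kappa [lambda [fT _ _ [lh _ _ _] le]]]]] := Ttensor.
have ii : i \in [fset i]%fset by rewrite in_fset1.
apply: eq_star_hom (le _ _ ii) _; apply: star_hom_comp (lh _).
by have [ih _ _ _] := fT [fset i]%fset; apply: (ih [` ii]%fset).
Qed.

Lemma tensor_comm i j (a : A i) (b : A j) :
  i != j -> iota a * iota b = iota b * iota a.
Proof.
have [TF [iotaF [kappa [lambda [fT _ _ [lh _ _ _] le]]]]] := Ttensor.
move=> ij; have iF : i \in [fset i; j]%fset by rewrite !inE eqxx.
have jF : j \in [fset i; j]%fset by rewrite !inE eqxx orbT.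
rewrite -(le _ _ iF) -(le _ _ jF) -!(star_homM (lh _)); congr (lambda _ _).
by have [_ com _ _] := fT [fset i; j]%fset; apply: (com [` iF]%fset [` jF]%fset).
Qed.

Lemma tensor_generates : generates (fun x => exists i (a : A i), x = iota a).
Proof.
have [TF [iotaF [kappa [lambda [fT _ _ [lh _ _ dT] le]]]]] := Ttensor.
move=> P algP clP Piota x; apply: (clP) => e e0.
have [y [F _ [t _ <-]] xy] := dense_approx dT x e0; exists (lambda F t) => //.
move: t {xy}; apply: (fin_tensor_generates (fT F)) (subalgebra_preim algP (lh F))
  (norm_closed_preim (lh F) clP) _.
by move=> _ [[i iF] [a ->]]; rewrite le; apply: Piota; exists i, a.
Qed.

End Tensor.

(** The infinite tensor product structure of a UHF algebra, flattened to a single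
    family of matrix algebras. *)
Definition matrix_system (R : realType) (A : cstarAlgType R) (J : choiceType)
    (k : J -> nat) (phi : forall j, 'M[R[i]]_(k j) -> A) : Prop :=
  [/\ forall j, linear (phi j), forall j, monoid_morphism (phi j),
      forall i j x y, i != j -> phi i x * phi j y = phi j y * phi i x
    & generates (fun a => exists j x, a = phi j x)].

Lemma matrix_algebra_system (R : realType) (k : nat) (A : cstarAlgType R) :
  is_matrix_algebra k A ->
  exists phi : unit -> 'M[R[i]]_k -> A, matrix_system phi.
Proof.
move=> [f [[f' _ fK] fl fm _]]; exists (fun=> f); split=> //.
by move=> P _ _ Pf a; apply: Pf; exists tt, (f' a).
Qed.

(** Generation is transitive because the inverse image of a closed subalgebra
    under the continuous homomorphism [iota i] is a closed subalgebra. *)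
Lemma tensor_matrix_system (R : realType) (I : choiceType) (A : I -> cstarAlgType R)
    (T : cstarAlgType R) (iota : forall i, A i -> T) (J : I -> choiceType)
    (k : forall i, J i -> nat) (phi : forall i (j : J i), 'M[R[i]]_(k i j) -> A i) :
  is_tensor iota -> (forall i, matrix_system (phi i)) ->
  @matrix_system R T {i : I & J i} (fun u => k (tag u) (tagged u))
    (fun u x => iota (tag u) (phi (tag u) (tagged u) x)).
Proof.
move=> Tt ms; have ih := tensor_star_hom Tt; split.
- move=> [i j] c x y /=; have [fl _ _ _] := ms i.
  by rewrite fl (star_homD (ih i)) (star_homZ (ih i)).
- move=> [i j] /=; have [_ fm _ _] := ms i; have [f1 fM] := fm j.
  by split=> [|x y] /=; rewrite ?f1 ?fM ?(star_hom1 (ih i)) ?(star_homM (ih i)).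
- move=> [i1 j1] [i2 j2] /=; have [e|i12 x y _] := eqVneq i1 i2; last exact: (tensor_comm Tt).
  move: j2; rewrite -e => j2 x y j12'; have j12 : j1 != j2 by apply: contraNneq j12' => ->.
  have [_ _ com _] := ms i1.
  by rewrite -!(star_homM (ih i1)) com.
- move=> P algP clP Pf; apply: (tensor_generates Tt) => // _ [i [a ->]].
  have [_ _ _ gen] := ms i.
  apply: gen (subalgebra_preim algP (ih i)) (norm_closed_preim (ih i) clP) _ a.
  by move=> _ [j [x ->]]; apply: Pf; exists (Tagged J j), x.
Qed.

Lemma matrix_prime_power_system (R : realType) (p : nat) (e : option nat)
    (A : cstarAlgType R) : is_matrix_prime_power p e A ->
  exists (J : choiceType) (k : J -> nat) (phi : forall j, 'M[R[i]]_(k j) -> A),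
    matrix_system phi.
Proof.
case: e => [e|] /=.
  by move=> /matrix_algebra_system[phi ms]; exists unit, (fun=> (p ^ e)%N), phi.
move=> [D [iota [/matrix_algebra_system[phi ms] tA]]].
by do 3 eexists; apply: (tensor_matrix_system tA (fun=> ms)).
Qed.

Lemma UHF_system (R : realType) (n : supernatural) (A : cstarAlgType R) :
  is_UHF n A ->
  exists (J : choiceType) (k : J -> nat) (phi : forall j, 'M[R[i]]_(k j) -> A),
    matrix_system phi.
Proof.
move=> [B [iota [Bp tA]]].
pose J p := cid (matrix_prime_power_system (Bp p)).
pose k p := cid (projT2 (J p)).
pose phi p := cid (projT2 (k p)).
do 3 eexists; exact: (tensor_matrix_system tA (fun p => projT2 (phi p))).
Qed.

(** * Matrix units and the trace of a permutation *)

(** Impredicative, so that linear identities are proved on spanning vectors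
    without coordinates. *)
Definition linear_span (K : nzRingType) (V : lmodType K) (S : V -> Prop) (x : V) : Prop :=
  forall P : V -> Prop, P 0 -> (forall a b, P a -> P b -> P (a + b)) ->
    (forall c a, P a -> P (c *: a)) -> (forall a, S a -> P a) -> P x.

Section LinearSpan.
Variables (K : nzRingType) (V : lmodType K) (S : V -> Prop).

Lemma linear_span0 : linear_span S 0. Proof. by []. Qed.
Lemma linear_spanD a b : linear_span S a -> linear_span S b -> linear_span S (a + b).
Proof.
by move=> Sa Sb P P0 PD PZ PS; apply: (PD); [exact: (Sa P) | exact: (Sb P)].
Qed.
Lemma linear_spanZ c a : linear_span S a -> linear_span S (c *: a).
Proof. by move=> Sa P P0 PD PZ PS; apply: (PZ); exact: (Sa P). Qed.
Lemma linear_span_sub a : S a -> linear_span S a.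
Proof. by move=> Sa P P0 PD PZ PS; apply: PS. Qed.
Lemma linear_span_sum (I : Type) (s : seq I) (Q : pred I) (F : I -> V) :
  (forall i, Q i -> linear_span S (F i)) -> linear_span S (\sum_(i <- s | Q i) F i).
Proof. exact: (big_ind (linear_span S) linear_span0 linear_spanD). Qed.

End LinearSpan.

Section MatrixUnits.
Variables (K : nzRingType) (A : algType K) (X : finType) (E : X -> X -> A).

Definition matrix_units : Prop :=
  (forall a b c d, E a b * E c d = if b == c then E a d else 0) /\
  \sum_a E a a = 1.

Definition unit_span : A -> Prop := linear_span (fun x => exists a b, x = E a b).

Hypothesis EU : matrix_units.

Lemma unit_spanM x y : unit_span x -> unit_span y -> unit_span (x * y).
Proof.
have [EM _] := EU.
move=> sx sy; apply: (sx (fun x => unit_span (x * y))) => [|a b sa sb|c a sa|_ [a [b ->]]].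
- by rewrite mul0r; apply: linear_span0.
- by rewrite mulrDl; apply: linear_spanD.
- by rewrite -scalerAl; apply: linear_spanZ.
apply: (sy (fun y => unit_span (E a b * y))) => [|x' y' sx' sy'|c x' sx'|_ [c [d ->]]].
- by rewrite mulr0; apply: linear_span0.
- by rewrite mulrDr; apply: linear_spanD.
- by rewrite -scalerAr; apply: linear_spanZ.
rewrite EM; case: ifP => _; last exact: linear_span0.
by apply: linear_span_sub; exists a, d.
Qed.

Lemma unit_span1 : unit_span 1.
Proof.
have [_ <-] := EU; apply: linear_span_sum => a _.
by apply: linear_span_sub; exists a, a.
Qed.

(** The trace of a matrix y with respect to the units E, as a multiple of 1. The
    formula makes sense for every y, even outside the span of the units. *)
Definition unit_trace (y : A) : A := \sum_r \sum_a E r a * y * E a r.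

(** Only one factor has to be a matrix: both sides are the sum of the
    E r b y E a r when v is E a b. *)
Lemma unit_trace_cyclic v y : unit_span v -> unit_trace (v * y) = unit_trace (y * v).
Proof.
have [EM _] := EU.
move=> sv; apply: (sv (fun v => unit_trace (v * y) = unit_trace (y * v)))
  => [|a b sa sb|c a sa|_ [a [b ->]]].
- by rewrite mul0r mulr0.
- rewrite mulrDl mulrDr /unit_trace.
  under eq_bigr do (under eq_bigr do rewrite mulrDr mulrDl; rewrite big_split).
  under [RHS]eq_bigr do (under eq_bigr do rewrite mulrDr mulrDl; rewrite big_split).
  by rewrite !big_split /=; congr (_ + _).
- rewrite -scalerAl -scalerAr /unit_trace.
  under eq_bigr do (under eq_bigr do rewrite -scalerAr -scalerAl; rewrite -scaler_sumr).
  under [RHS]eq_bigr do (under eq_bigr do rewrite -scalerAr -scalerAl; rewrite -scaler_sumr).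
  by rewrite -!scaler_sumr; congr (_ *: _).
- apply: eq_bigr => r _; rewrite (bigD1 a) //= [RHS](bigD1 b) //=.
  rewrite !mulrA EM eqxx -!mulrA EM eqxx !big1 // => i ib.
    by rewrite -!mulrA EM eq_sym (negPf ib) !mulr0.
  by rewrite !mulrA EM (negPf ib) !mul0r.
Qed.

Variables (alpha : A -> A) (s : X -> X).
Hypotheses (alphaD : forall a b, alpha (a + b) = alpha a + alpha b).
Hypotheses (alphaZ : forall c a, alpha (c *: a) = c *: alpha a).
Hypotheses (s_inj : injective s).
Hypotheses (alphaE : forall a b, alpha (E a b) = E (s a) (s b)).

(** The permutation matrix of s. *)
Let u : A := \sum_a E (s a) a.

Lemma shift_intertwines v : unit_span v -> u * v = alpha v * u.
Proof.
have [EM _] := EU.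
have alpha0 : alpha 0 = 0 by rewrite -(scale0r (0 : A)) alphaZ !scale0r.
move=> sv; apply: (sv (fun v => u * v = alpha v * u)) => [|a b sa sb|c a sa|_ [a [b ->]]].
- by rewrite alpha0 mulr0 mul0r.
- by rewrite alphaD mulrDr mulrDl sa sb.
- by rewrite alphaZ -scalerAr -scalerAl sa.
- rewrite alphaE mulr_suml mulr_sumr (bigD1 a) //= [RHS](bigD1 b) //= !EM !eqxx.
  rewrite !big1 // => i ib; rewrite EM.
    by rewrite (inj_eq s_inj) eq_sym (negPf ib).
  by rewrite (negPf ib).
Qed.

Lemma unit_trace_shift : unit_trace u = #|[pred a | s a == a]|%:R.
Proof.
have [EM E1] := EU.
transitivity (\sum_r \sum_(a | s a == a) E r r).
  apply: eq_bigr => r _; rewrite [RHS]big_mkcond; apply: eq_bigr => a _.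
  rewrite mulr_sumr mulr_suml (bigD1 a) //= big1 ?addr0 => [|i ia].
    by rewrite !EM eq_sym; case: ifP; rewrite ?mul0r // EM eqxx.
  by rewrite -mulrA EM (negPf ia) mulr0.
rewrite exchange_big /=; under eq_bigr do rewrite E1.
by rewrite sumr_const.
Qed.

(** Both sides are traces: u = v (w u) has the trace of (w u) v = omega w v u,
    which is omega times that of u, and the trace of a permutation matrix is its
    number of fixed points. *)
Lemma eigenvector_fixed_count (omega : K) v w :
  unit_span v -> alpha v = omega *: v -> v * w = 1 -> w * v = 1 ->
  #|[pred a | s a == a]|%:R = omega *: (#|[pred a | s a == a]|%:R : A).
Proof.
move=> sv av vw wv; rewrite -unit_trace_shift.
have tZ (y : A) : unit_trace (omega *: y) = omega *: unit_trace y.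
  rewrite /unit_trace scaler_sumr; apply: eq_bigr => r _; rewrite scaler_sumr.
  by apply: eq_bigr => a _; rewrite -scalerAr -scalerAl.
have uE : u = v * (w * u) by rewrite mulrA vw mul1r.
rewrite {1}uE (unit_trace_cyclic _ sv) -mulrA (shift_intertwines sv) av.
by rewrite -scalerAl -scalerAr mulrA wv mul1r tZ.
Qed.

End MatrixUnits.

(** * Products of commuting systems of matrix units *)

Section CommutingProducts.
Variables (A : pzRingType) (I : eqType).

(** Products over a finite type follow its enumeration, so moving a factor or
    reindexing needs this. *)
Lemma comm_prod_perm (F : I -> A) (r1 r2 : seq I) :
  (forall i j, i != j -> F i * F j = F j * F i) ->
  perm_eq r1 r2 -> \prod_(i <- r1) F i = \prod_(i <- r2) F i.
Proof.
move=> com; elim: r1 r2 => [|x r1 IH] r2; first by rewrite perm_sym => /perm_nilP ->.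
move=> r12; have xr2 : x \in r2 by rewrite -(perm_mem r12) mem_head.
case/splitPr: xr2 r12 => p1 p2; rewrite perm_sym perm_catC /= perm_cons.
rewrite perm_catC perm_sym => /IH; rewrite big_cons !big_cat /= big_cons => ->.
rewrite !mulrA; congr (_ * _); apply: commr_prod => i _.
by have [->|] := eqVneq x i; last exact: com.
Qed.

Lemma comm_prodM (F G : I -> A) (r : seq I) :
  uniq r -> (forall i j, i != j -> F i * G j = G j * F i) ->
  \prod_(i <- r) (F i * G i) = \prod_(i <- r) F i * \prod_(i <- r) G i.
Proof.
move=> + com; elim: r => [_|x r IH /= /andP[xr /IH {}IH]].
  by rewrite !big_nil mulr1.
rewrite !big_cons IH !mulrA; congr (_ * _); rewrite -!mulrA; congr (_ * _).
rewrite big_seq; apply: commr_prod => i ir; apply/esym/com.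
by apply: contraNneq xr => <-.
Qed.

End CommutingProducts.

Lemma prod_sum_fprod (A : pzSemiRingType) (I : finType) (X : I -> finType)
    (F : forall i, X i -> A) :
  \prod_i \sum_(x : X i) F i x = \sum_(t : fprod X) \prod_i F i (t i).
Proof.
have -> : \sum_(t : fprod X) \prod_i F i (t i) =
    \sum_(t : fprod X) \prod_i [ffun x => F i x] (t i).
  by apply: eq_bigr => t _; apply: eq_bigr => i _; rewrite ffunE.
rewrite (big_fprod _ _ (fun i => [ffun x => F i x])).
rewrite -(bigA_distr_big_dep (tagged_with X) (fun i => untag 0 [ffun x => F i x])).
apply: eq_bigr => i _; rewrite -(big_tag (fun i => [ffun x => F i x])).
by apply: eq_bigr => x _; rewrite ffunE.
Qed.

Section ProductUnits.
Variables (K : nzRingType) (A : algType K) (I : finType) (X : I -> finType).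
Variable e : forall i, X i -> X i -> A.
Arguments e : clear implicits.
Hypothesis eU : forall i, matrix_units (e i).
Hypothesis ecom : forall i j a b c d, i != j -> e i a b * e j c d = e j c d * e i a b.

Definition prod_units (t t' : fprod X) : A := \prod_i e i (t i) (t' i).

Lemma prod_unitsM t1 t2 t3 t4 :
  prod_units t1 t2 * prod_units t3 t4 =
    \prod_i (if t2 i == t3 i then e i (t1 i) (t4 i) else 0).
Proof.
rewrite /prod_units -comm_prodM ?index_enum_uniq //.
  by apply: eq_bigr => i _; have [-> _] := eU i.
by move=> i j ij; apply: ecom.
Qed.

(** Matrix units of a finite tensor product are products of matrix units of the
    factors, indexed by the choice functions t. Distributing the product of
    the sums of the e i x x, each equal to 1, shows that they sum to 1. *)
Lemma prod_matrix_units : matrix_units prod_units.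
Proof.
split=> [t1 t2 t3 t4|].
  rewrite prod_unitsM; case: eqVneq => [->|t23].
    by apply: eq_bigr => i _; rewrite eqxx.
  have [i ti] : exists i, t2 i != t3 i.
    apply/existsP; rewrite -negb_forall; apply: contra t23 => /forallP t23.
    by apply/eqP/fprodP => i; apply/eqP.
  have : i \in index_enum I by rewrite mem_index_enum.
  case/path.splitPr => p1 p2; rewrite big_cat big_cons /= (negPf ti) mul0r mulr0.
  by [].
rewrite -(prod_sum_fprod (fun i x => e i x x)) big1 // => i _; by have [_ ->] := eU i.
Qed.

(** A matrix unit of one factor moves the index t in that coordinate only. *)
Lemma prod_unitsZl i a b t :
  e i a b * prod_units t t =
    if b == t i then prod_units (fprod_of_fun (@eqtype.dfwith I X t i a)) t else 0.
Proof.
have split_i t' t'' : prod_units t' t'' =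
    e i (t' i) (t'' i) * \prod_(j <- rem i (index_enum I)) e j (t' j) (t'' j).
  transitivity (\prod_(j <- i :: rem i (index_enum I)) e j (t' j) (t'' j)).
    apply: comm_prod_perm (perm_to_rem (mem_index_enum i)).
    by move=> j k jk; apply: ecom.
  by rewrite big_cons.
rewrite !split_i mulrA; have [-> _] := eU i; case: eqVneq => _; last by rewrite mul0r.
rewrite fprodE eqtype.dfwith_in; congr (_ * _); apply: eq_big_seq => j.
rewrite mem_rem_uniq ?index_enum_uniq // inE => /andP[ji _].
by rewrite fprodE eqtype.dfwith_out // eq_sym.
Qed.

(** Multiply by 1, written as the sum of the diagonal product units. *)
Lemma unit_span_factor i a b : unit_span prod_units (e i a b).
Proof.
have [_ E1] := prod_matrix_units.
rewrite -[e i a b]mulr1 -E1 mulr_sumr; apply: linear_span_sum => t _.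
rewrite prod_unitsZl; case: ifP => _; last exact: linear_span0.
by apply: linear_span_sub; do 2 eexists.
Qed.

End ProductUnits.

(** * Finite stages of the Bernoulli shift *)

Definition norm_closure (K : numFieldType) (V : normedZmodType K)
    (U : V -> Prop) (x : V) : Prop :=
  forall e : K, 0 < e -> exists2 u, U u & `|x - u| < e.

Lemma norm_closure_closed (K : numFieldType) (V : normedZmodType K)
    (U : V -> Prop) : norm_closed (norm_closure U).
Proof.
move=> x clx e e0; have e2 : 0 < e / 2 by rewrite divr_gt0.
have [y /(_ _ e2)[u Uu yu] xy] := clx _ e2; exists u => //.
apply: le_lt_trans (ler_distD y _ _) _.
by rewrite [ltRHS](splitr e) ltrD.
Qed.

Lemma norm_closure_subalgebra (R : realType) (A : cstarAlgType R) (U : A -> Prop) :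
  is_subalgebra U -> is_subalgebra (norm_closure U).
Proof.
move=> [U1 UD UZ UM]; split.
- by move=> e e0; exists 1; rewrite // subrr normr0.
- move=> a b cla clb e e0; have e2 : 0 < e / 2 by rewrite divr_gt0.
  have [u Uu au] := cla _ e2; have [v Uv bv] := clb _ e2.
  exists (u + v); first exact: UD.
  rewrite opprD addrACA; apply: le_lt_trans (ler_normD _ _) _.
  by rewrite [ltRHS](splitr e) ltrD.
- move=> c a cla e e0; have c1 : 0 < `|c| + 1 by rewrite ltr_wpDl.
  have [u Uu au] := cla _ (divr_gt0 e0 c1); exists (c *: u); first exact: UZ.
  rewrite -scalerBr normrZ; apply: le_lt_trans (_ : (`|c| + 1) * `|a - u| < e).
    by rewrite ler_wpM2r // lerDl.
  by rewrite mulrC -ltr_pdivlMr.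
- move=> a b cla clb e e0; have e2 : 0 < e / 2 by rewrite divr_gt0.
  have b1 : 0 < `|b| + 1 by rewrite ltr_wpDl.
  have [u Uu au] := cla _ (divr_gt0 e2 b1).
  have u1 : 0 < `|u| + 1 by rewrite ltr_wpDl.
  have [v Uv bv] := clb _ (divr_gt0 e2 u1); exists (u * v); first exact: UM.
  have -> : a * b - u * v = (a - u) * b + u * (b - v).
    by rewrite mulrBl mulrBr addrA subrK.
  apply: le_lt_trans (ler_normD _ _) _; rewrite [ltRHS](splitr e) ltrD //.
    apply: le_lt_trans (cnormM _ _) _.
    apply: le_lt_trans (_ : `|a - u| * (`|b| + 1) < _); first by rewrite ler_wpM2l // lerDl.
    by rewrite -ltr_pdivlMr.
  apply: le_lt_trans (cnormM _ _) _.
  apply: le_lt_trans (_ : (`|u| + 1) * `|b - v| < _); first by rewrite ler_wpM2r // lerDl.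
  by rewrite mulrC -ltr_pdivlMr.
Qed.

Definition generated_subalgebra (R : realType) (A : cstarAlgType R)
    (S : A -> Prop) (x : A) : Prop :=
  forall P : A -> Prop, is_subalgebra P -> (forall a, S a -> P a) -> P x.

Section GeneratedSubalgebra.
Variables (R : realType) (A : cstarAlgType R) (S : A -> Prop).

Lemma generated_subalgebraP : is_subalgebra (generated_subalgebra S).
Proof.
split=> [|a b Sa Sb|c a Sa|a b Sa Sb] P algP SP; have [P1 PD PZ PM] := algP => //.
- by apply: PD; [exact: (Sa P) | exact: (Sb P)].
- by apply: PZ; exact: (Sa P).
- by apply: PM; [exact: (Sa P) | exact: (Sb P)].
Qed.

Lemma generated_subalgebra_gen a : S a -> generated_subalgebra S a.
Proof. by move=> Sa P _; apply. Qed.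

Lemma generated_subalgebra_mono (S' : A -> Prop) a :
  (forall x, S x -> S' x) -> generated_subalgebra S a -> generated_subalgebra S' a.
Proof. by move=> SS' Sa P algP S'P; apply: (Sa P) => // x /SS'; apply: S'P. Qed.

End GeneratedSubalgebra.

Lemma unit_span_subalgebra (R : realType) (A : cstarAlgType R) (X : finType)
    (E : X -> X -> A) : matrix_units E -> is_subalgebra (unit_span E).
Proof.
move=> EU; split=> [|a b|c a|a b].
- exact: unit_span1.
- exact: linear_spanD.
- exact: linear_spanZ.
- exact: unit_spanM.
Qed.

Lemma matrix_morphism_units (K : comNzRingType) (A : algType K) (n : nat)
    (f : 'M[K]_n -> A) : linear f -> monoid_morphism f ->
  matrix_units (fun a b => f (delta_mx a b)) /\
  forall x, unit_span (fun a b => f (delta_mx a b)) (f x).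
Proof.
move=> fl [f1 fM].
have fD a b : f (a + b) = f a + f b by have := fl 1 a b; rewrite !scale1r.
have f0 : f 0 = 0 by apply/(addrI (f 0)); rewrite -fD !addr0.
have fZ c a : f (c *: a) = c *: f a by have := fl c a 0; rewrite f0 !addr0.
have fS I (s : seq I) F : f (\sum_(i <- s) F i) = \sum_(i <- s) f (F i).
  exact: (big_morph f fD f0).
split; first split=> [a b c d|].
- rewrite -fM [_ * _]mul_delta_mx_cond; case: eqP => _ //=.
- rewrite -fS -f1; congr (f _).
  rewrite [RHS](scalar_mx_sum_delta n (1 : K)).
  by apply: eq_bigr => i _; rewrite scale1r.
- move=> x; rewrite (matrix_sum_delta x) fS; apply: linear_span_sum => a _.
  rewrite fS; apply: linear_span_sum => b _; rewrite fZ; apply: linear_spanZ.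
  by apply: linear_span_sub; exists a, b.
Qed.

Lemma star_hom_matrix_units (R : realType) (A B : cstarAlgType R) (X : finType)
    (E : X -> X -> A) (f : A -> B) :
  star_hom f -> matrix_units E -> matrix_units (fun a b => f (E a b)).
Proof.
move=> fh [EM E1]; split=> [a b c d|].
  by rewrite -(star_homM fh) EM; case: ifP => _ //; apply: star_hom0.
by rewrite -(star_hom_sum fh) E1 (star_hom1 fh).
Qed.

Section Bernoulli.
Variables (R : realType) (G : finGroupType) (Z : choiceType) (act : G -> Z -> Z).
Variables (M T : cstarAlgType R) (iota : Z -> M -> T) (alpha : G -> T -> T).
Variables (J : choiceType) (k : J -> nat) (phi : forall j, 'M[R[i]]_(k j) -> M).
Arguments phi : clear implicits.
Hypotheses (actP : is_left_action act) (Ttensor : is_tensor_power iota).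
Hypotheses (alphaP : is_bernoulli_shift act iota alpha) (phiP : matrix_system phi).

Let iota_hom z : star_hom (iota z) := tensor_star_hom Ttensor z.
Let alpha_hom g : star_hom (alpha g). Proof. by have [[_ ?] _] := alphaP. Qed.
Let alpha_iota g z a : alpha g (iota z a) = iota (act g z) a.
Proof. by have [_ ->] := alphaP. Qed.

(** The part of the tensor power that only involves the points in s and the
    matrix algebras in m. *)
Definition finite_stage (s : seq Z) (m : seq J) : T -> Prop :=
  generated_subalgebra
    (fun x => exists z j y, [/\ z \in s, j \in m & x = iota z (phi j y)]).

Lemma finite_stage_mono (s s' : seq Z) (m m' : seq J) x :
  {subset s <= s'} -> {subset m <= m'} -> finite_stage s m x -> finite_stage s' m' x.
Proof.
move=> ss' mm'; apply: generated_subalgebra_mono => _ [z [j [y [zs jm ->]]]].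
by exists z, j, y; split; [apply: ss' | apply: mm' |].
Qed.

(** The stages are directed, so their union is a subalgebra; its closure contains
    every iota z a by continuity of iota z, hence is everything. *)
Lemma finite_stage_dense (x : T) (e : R[i]) :
  0 < e -> exists s m, exists2 u, finite_stage s m u & `|x - u| < e.
Proof.
pose U x := exists s m, finite_stage s m x.
have algU : is_subalgebra U.
  have join a b : U a -> U b ->
      exists s m, finite_stage s m a /\ finite_stage s m b.
    move=> [s [m sa]] [s' [m' sb]]; exists (s ++ s'), (m ++ m'); split.
      by apply: finite_stage_mono sa => z; rewrite mem_cat => ->.
    by apply: finite_stage_mono sb => z; rewrite mem_cat => ->; rewrite orbT.
  have algS s m : is_subalgebra (finite_stage s m) := generated_subalgebraP _.
  split=> [|a b Ua Ub|c a [s [m sa]]|a b Ua Ub].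
  - by exists [::], [::]; have [] := algS [::] [::].
  - have [s [m [sa sb]]] := join _ _ Ua Ub; exists s, m.
    by have [_ + _ _] := algS s m; apply.
  - by exists s, m; have [_ _ + _] := algS s m; apply.
  - have [s [m [sa sb]]] := join _ _ Ua Ub; exists s, m.
    by have [_ _ _ +] := algS s m; apply.
have algC := norm_closure_subalgebra algU.
have clC : norm_closed (norm_closure U) by exact: norm_closure_closed.
suff : norm_closure U x by move=> clx /clx[u [s [m su]] xu]; exists s, m, u.
move: x; apply: (tensor_generates Ttensor) => // _ [z [a ->]].
have [_ _ _ gen] := phiP.
move: a; apply: (gen (fun a => norm_closure U (iota z a))).
- exact: subalgebra_preim.
- exact: norm_closed_preim.
move=> _ [j [y ->]] d d0; exists (iota z (phi j y)); last by rewrite subrr normr0.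
exists [:: z], [:: j]; apply: generated_subalgebra_gen; exists z, j, y.
by rewrite !mem_head.
Qed.

Lemma finite_stage_shift (s : seq Z) (m : seq J) (h : G) x :
  {in s, forall z, act h z \in s} -> finite_stage s m x -> finite_stage s m (alpha h x).
Proof.
move=> sh sx; apply: (sx (fun x => finite_stage s m (alpha h x))).
  have algS : is_subalgebra (finite_stage s m) := generated_subalgebraP _.
  exact: (subalgebra_preim algS (alpha_hom h)).
move=> _ [z [j [y [zs jm ->]]]]; rewrite alpha_iota.
by apply: generated_subalgebra_gen; exists (act h z), j, y; split=> //; apply: sh.
Qed.

(** Two layers of products: within one point z, over the matrix algebras in m,
    whose sizes vary; then over the points in s, where the index type is constant
    so that the action can permute it. *)
Section Units.
Variables (s : {fset Z}) (m : {fset J}).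

Let local_index : finType := fprod (fun j : m => 'I_(k (val j))).
Let local_unit : local_index -> local_index -> M :=
  prod_units (fun (j : m) a b => phi (val j) (delta_mx a b)).
Let stage_index : finType := fprod (fun _ : s => local_index).
Let stage_unit : stage_index -> stage_index -> T :=
  prod_units (fun (z : s) a b => iota (val z) (local_unit a b)).

Let phi_comm (i j : m) a b c d : i != j ->
  phi (val i) (delta_mx a b) * phi (val j) (delta_mx c d) =
  phi (val j) (delta_mx c d) * phi (val i) (delta_mx a b).
Proof. by move=> ij; have [_ _ com _] := phiP; apply: com. Qed.

Let phi_units j :
  matrix_units (fun a b => phi j (delta_mx a b)) /\
  forall x, unit_span (fun a b => phi j (delta_mx a b)) (phi j x).
Proof. by have [fl fm _ _] := phiP; apply: matrix_morphism_units. Qed.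

Let local_units : matrix_units local_unit.
Proof.
apply: prod_matrix_units => [j|]; last exact: phi_comm.
by have [] := phi_units (val j).
Qed.

Let iota_units z : matrix_units (fun a b => iota z (local_unit a b)).
Proof. exact: star_hom_matrix_units. Qed.

Let iota_comm (z z' : s) a b c d : z != z' ->
  iota (val z) (local_unit a b) * iota (val z') (local_unit c d) =
  iota (val z') (local_unit c d) * iota (val z) (local_unit a b).
Proof. by move=> zz'; apply: (tensor_comm Ttensor). Qed.

Lemma stage_units : matrix_units stage_unit.
Proof. by apply: prod_matrix_units => [z|]; [exact: iota_units | exact: iota_comm]. Qed.

(** The span of the units is an algebra, so only generators matter, and each of
    them lives in one factor of the product. *)
Lemma finite_stage_span x : finite_stage s m x -> unit_span stage_unit x.
Proof.
move/(_ (unit_span stage_unit)); apply; first exact/unit_span_subalgebra/stage_units.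
move=> _ [z [j [y [zs jm ->]]]].
have iota_span a : unit_span local_unit a -> unit_span stage_unit (iota z a).
  move/(_ (fun a => unit_span stage_unit (iota z a))); apply.
  - by rewrite (star_hom0 (iota_hom z)); apply: linear_span0.
  - by move=> b c sb sc; rewrite (star_homD (iota_hom z)); apply: linear_spanD.
  - by move=> c b sb; rewrite (star_homZ (iota_hom z)); apply: linear_spanZ.
  - move=> _ [b [c ->]].
    have := @unit_span_factor _ _ _ _ (fun (z : s) a b => iota (val z) (local_unit a b)).
    by move/(_ (fun z => iota_units (val z)) iota_comm [` zs]%fset b c).
apply: iota_span; have [_ /(_ y)] := phi_units j.
move/(_ (unit_span local_unit)); apply.
- exact: linear_span0.
- exact: linear_spanD.
- exact: linear_spanZ.
- move=> _ [b [c ->]].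
  have := @unit_span_factor _ _ _ _ (fun (j : m) a b => phi (val j) (delta_mx a b)).
  by move/(_ (fun j => (phi_units (val j)).1) phi_comm [` jm]%fset b c).
Qed.

Hypothesis s_inv : forall h, {in s, forall z, act h z \in s}.

Let act_s (h : G) (z : s) : s := [` s_inv h (valP z)]%fset.

Let act_sK h : cancel (act_s h) (act_s h^-1%g).
Proof.
have [act1 actM] := actP.
by move=> z; apply: val_inj; rewrite /= -actM mulVg act1.
Qed.

Let shift (h : G) (t : stage_index) : stage_index :=
  fprod_of_fun (fun z => t (act_s h^-1%g z)).

Let shift_inj h : injective (shift h).
Proof.
move=> t t' tt'; apply/fprodP => z.
have := congr1 (fun t : stage_index => t (act_s h z)) tt'.
by rewrite /shift /= !fprodE act_sK.
Qed.

Lemma alpha_stage_unit h t t' :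
  alpha h (stage_unit t t') = stage_unit (shift h t) (shift h t').
Proof.
rewrite /stage_unit /prod_units (star_hom_prod (alpha_hom h)).
pose F z := iota (val z) (local_unit (shift h t z) (shift h t' z)).
transitivity (\prod_(z : s) F (act_s h z)).
  by apply: eq_bigr => z _; rewrite alpha_iota /F /shift !fprodE act_sK.
rewrite -(big_map (act_s h) xpredT F); apply: comm_prod_perm.
  by move=> z z' zz'; apply: iota_comm.
apply: uniq_perm; rewrite ?index_enum_uniq //.
  by rewrite map_inj_uniq ?index_enum_uniq //; apply: can_inj (act_sK h).
move=> z; rewrite mem_index_enum; apply/mapP; exists (act_s h^-1%g z).
  by rewrite mem_index_enum.
by rewrite -{1}(invgK h) act_sK.
Qed.

(** Constant functions on s are fixed by every shift, so the trace of the shift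
    is a positive integer c, and c = omega c forces omega = 1. *)
Lemma finite_stage_eigenvalue h (x w : T) (omega : R[i]) :
  finite_stage s m x -> alpha h x = omega *: x -> x * w = 1 -> w * x = 1 -> omega = 1.
Proof.
move=> /finite_stage_span sx ax xw wx.
have := eigenvector_fixed_count stage_units (star_homD (alpha_hom h))
  (star_homZ (alpha_hom h)) (@shift_inj h) (alpha_stage_unit h) sx ax xw wx.
set n := #|_|; have n0 : (0 < n)%N.
  (* The index type is inhabited since its diagonal units sum to 1 <> 0. *)
  have [b _] : exists b : local_index, True.
    case: (pickP (@predT local_index)) => [b _|none]; first by exists b.
    have [_] := local_units; rewrite big_pred0 // => /esym/eqP.
    by rewrite oner_eq0.
  apply/card_gt0P; exists (fprod_of_fun (fun=> b)); rewrite inE.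
  by apply/eqP/fprodP => z; rewrite /shift !fprodE.
move/eqP; rewrite -[n%:R]scaler_nat scalerA -subr_eq0 -scalerBl scaler_eq0 oner_eq0 orbF.
rewrite -{1}[n%:R]mul1r -mulrBl mulf_eq0 pnatr_eq0 [n == 0%N]eqn0Ngt n0 orbF subr_eq0.
by move/eqP.
Qed.

End Units.
End Bernoulli.

(** * From the Rokhlin property to an eigenvector *)

(** A root of 1 + X + ... + X^(q-1); it is not 1, where the value is q. *)
Lemma nontrivial_unity_root (R : realType) (q : nat) :
  (1 < q)%N -> exists2 omega : R[i], omega ^+ q = 1 & omega != 1.
Proof.
move=> q1; pose p : {poly R[i]} := \sum_(i < q) 'X^i.
have sp : size p = q.
  by rewrite /p; under eq_bigr do rewrite -['X^_]mul1r -polyC1 mul_polyC;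
    rewrite -(poly_def _ (fun=> 1)) size_poly_eq ?oner_eq0.
have [w] : exists w, root p w by apply/closed_rootP; rewrite sp gtn_eqF.
move/rootP; rewrite horner_sum; under eq_bigr do rewrite hornerXn.
move=> w0; exists w.
  by apply/eqP; rewrite -subr_eq0 subrX1 w0 mulr0.
apply: contra_eqN w0 => /eqP ->; under eq_bigr do rewrite expr1n.
by rewrite sumr_const card_ord pnatr_eq0 -lt0n ltnW.
Qed.

Lemma unity_root_norm (K : numDomainType) (q : nat) (omega : K) :
  (0 < q)%N -> omega ^+ q = 1 -> `|omega| = 1.
Proof.
by move=> q0 oq; apply/eqP; rewrite -(@pexpr_eq1 _ _ q) // -normrX oq normr1.
Qed.

(** Write h = g^i r with r the representative of the right coset <[g]> h, which
    g h shares, and let f h = i; this exponent matters only modulo the order of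
    g. *)
Lemma translation_character (K : comNzRingType) (G : finGroupType) (g : G) (omega : K) :
  omega ^+ #[g]%g = 1 ->
  exists f : G -> nat, forall h, omega ^+ f (g * h)%g = omega * omega ^+ f h.
Proof.
move=> oq; have /choice[f fP] : forall h, exists i,
    h = (g ^+ i * repr (<[g]> :* h))%g.
  move=> h; have /rcosetP[a ag ra] := mem_repr_rcoset <[g]>%G h.
  have /cycleP[i ai] := groupVr ag; exists i.
  by rewrite -ai ra mulgA mulVg mul1g.
exists f => h; rewrite -exprS -(expr_mod _ oq) -[RHS](expr_mod _ oq).
congr (_ ^+ _); apply/eqP; rewrite -eq_expg_mod_order; apply/eqP.
apply: (mulIg (repr (<[g]> :* h))%g).
have := fP (g * h)%g; rewrite rcosetM rcoset_id ?cycle_id // => <-.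
by rewrite expgS -mulgA -fP.
Qed.

Lemma orthogonal_sumM (R : realType) (A : cstarAlgType R) (I : finType) (e : I -> A)
    (a b : I -> R[i]) :
  (forall i, e i * e i = e i) -> (forall i j, i != j -> e i * e j = 0) ->
  (\sum_i a i *: e i) * (\sum_i b i *: e i) = \sum_i (a i * b i) *: e i.
Proof.
move=> ee e0; rewrite mulr_suml; apply: eq_bigr => i _.
rewrite mulr_sumr (bigD1 i) //= big1 ?addr0 => [|j ji].
  by rewrite -scalerAl -scalerAr ee scalerA.
by rewrite -scalerAl -scalerAr e0 1?eq_sym // !scaler0.
Qed.

(** v is the sum of the omega^(f h) e_h, with f from [translation_character].
    The automorphism alpha_(g^i) moves e_h near e_(g^i h), whose weight in v is
    omega^i times that of e_h. *)
Lemma rokhlin_unitary (R : realType) (G : finGroupType) (A : cstarAlgType R)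
    (alpha : G -> A -> A) (g : G) (omega d : R[i]) :
  is_cstar_action alpha -> rokhlin_property alpha ->
  omega ^+ #[g]%g = 1 -> 0 < d ->
  exists v : A, [/\ star v * v = 1, v * star v = 1
    & forall i, `|omega ^+ i *: alpha (g ^+ i)%g v - v| <= d].
Proof.
move=> [_ ah] rok oq d0.
have no : `|omega| = 1 := unity_root_norm (order_gt0 g) oq.
have [f fM] := translation_character oq.
have nf h : `|omega ^+ f h| = 1 by rewrite normrX no expr1n.
have G0 : 0 < #|G|%:R :> R[i] by rewrite ltr0n; apply/card_gt0P; exists g.
have eps_d : (complex.Re (d / #|G|%:R))%:C = d / #|G|%:R.
  by rewrite RRe_real // ger0_real // ltW // divr_gt0.
have [//||e [[eproj eorth] e1 ae _]] := rok set0 (complex.Re (d / #|G|%:R)).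
  by rewrite -ltcR eps_d divr_gt0.
have ee h : e h * e h = e h by have [] := eproj h.
have se h : star (e h) = e h by have [] := eproj h.
pose v := \sum_h omega ^+ f h *: e h.
have sv : star v = \sum_h ((omega ^+ f h)^*)%R *: e h.
  by rewrite /v star_sum; apply: eq_bigr => h _; rewrite starZ se.
exists v; split.
- rewrite sv /v orthogonal_sumM // -e1; apply: eq_bigr => h _.
  by rewrite mulrC -normCK nf expr1n scale1r.
- rewrite sv /v orthogonal_sumM // -e1; apply: eq_bigr => h _.
  by rewrite -normCK nf expr1n scale1r.
move=> i.
have fMi h : omega ^+ f (g ^+ i * h)%g = omega ^+ i * omega ^+ f h.
  elim: i => [|i IH]; first by rewrite expg0 mul1g mul1r.
  by rewrite expgS -mulgA fM IH exprS mulrA.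
have vE : v = \sum_h (omega ^+ i * omega ^+ f h) *: e (g ^+ i * h)%g.
  rewrite /v (reindex_inj (mulgI (g ^+ i)%g)) /=.
  by apply: eq_bigr => h _; rewrite fMi.
rewrite [X in _ - X]vE (star_hom_sum (ah _)) scaler_sumr -sumrB.
apply: le_trans (ler_norm_sum _ _ _) _.
apply: le_trans (_ : \sum_(h : G) d / #|G|%:R <= d).
  apply: ler_sum => h _; rewrite (star_homZ (ah _)) scalerA -scalerBr normrZ.
  by rewrite normrM normrX no expr1n nf !mul1r -eps_d ltW.
by rewrite sumr_const -[leLHS]mulr_natr divfK ?gt_eqF.
Qed.

(** Applying omega alpha_g shifts the summation index by one, and the summand is
    periodic of period q. *)
Lemma cyclic_average (R : realType) (A : cstarAlgType R) (G : finGroupType)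
    (alpha : G -> A -> A) (g : G) (omega : R[i]) (b : A) :
  is_cstar_action alpha -> omega ^+ #[g]%g = 1 ->
  omega *: alpha g (\sum_(i < #[g]%g) omega ^+ i *: alpha (g ^+ i)%g b) =
    \sum_(i < #[g]%g) omega ^+ i *: alpha (g ^+ i)%g b.
Proof.
move=> [[_ aM] ah] oq; rewrite (star_hom_sum (ah g)) scaler_sumr.
pose F i := omega ^+ i *: alpha (g ^+ i)%g b.
transitivity (\sum_(i < #[g]%g) F i.+1).
  by apply: eq_bigr => i _; rewrite (star_homZ (ah g)) -aM -expgS scalerA -exprS.
have Fq : F #[g]%g = F 0%N by rewrite /F oq expg_order.
apply: (addrI (F 0%N)).
rewrite -(big_ord_recl #[g]%g (fun i => F i)) big_ord_recr /= Fq addrC.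
by [].
Qed.

(** star v * b is within 1/2 of 1. *)
Lemma invertible_near_unitary (R : realType) (A : cstarAlgType R) (v b : A) :
  star v * v = 1 -> v * star v = 1 -> `|v - b| <= 2^-1 ->
  exists2 w, b * w = 1 & w * b = 1.
Proof.
move=> sv vs vb; have [|w] := @invertible_near1 _ _ (star v * b).
  rewrite -sv -mulrBr; apply: le_trans (cnormM _ _) _.
  by rewrite cnorm_star (cnorm_unitary sv) mul1r.
move=> xw wx; exists (w * star v); last by rewrite -mulrA.
have -> : b = v * (star v * b) by rewrite mulrA vs mul1r.
by rewrite -mulrA [star v * b * _]mulrA xw mul1r.
Qed.

Theorem corollary2p10 (R : realType) (G : finGroupType) (Z : choiceType)
    (act : G -> Z -> Z) (n : supernatural) (M T : cstarAlgType R)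
    (iota : Z -> M -> T) (alpha : G -> T -> T) :
  (exists g : G, g <> 1%g) ->
  is_left_action act ->
  infinite_type n ->
  is_UHF n M ->
  is_tensor_power iota ->
  is_bernoulli_shift act iota alpha ->
  ~ rokhlin_property alpha.
Proof.
move=> [g g1] actP _ /UHF_system[J [k [phi phiP]]] Tt bern rok.
have [alphaP _] := bern; have [_ ah] := alphaP.
have q1 : (1 < #[g]%g)%N by rewrite order_gt1; apply/eqP.
have [omega oq o1] := nontrivial_unity_root R q1.
have no : `|omega| = 1 := unity_root_norm (order_gt0 g) oq.
have [||v [sv vs va]] := @rokhlin_unitary _ _ _ _ g omega 4^-1 alphaP rok => //.
have [|s [m [u su vu]]] := finite_stage_dense Tt phiP v (e := 8^-1) => //.
(* The error budget: |v - u| contributes at most 2/8, because alpha is bounded by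
   2, and the failure of v to be an exact eigenvector at most 1/4; the sum is the
   1/2 that invertibility of b tolerates. *)
pose Z0 := [fset act h z | h in [set: G]%SET, z in s]%fset.
pose J0 := [fset j in m]%fset.
have Z0_inv h : {in Z0, forall z, act h z \in Z0}.
  move=> _ /imfset2P[h' /= _ [z /= zs ->]]; have [_ <-] := actP.
  by apply: in_imfset2; rewrite ?inE.
have {}su : finite_stage iota phi Z0 J0 u.
  apply: finite_stage_mono su => [z zs|j jm]; last by rewrite !inE.
  by have [act1 _] := actP; rewrite -[z]act1; apply: in_imfset2; rewrite ?inE.
pose S := \sum_(i < #[g]%g) omega ^+ i *: alpha (g ^+ i)%g u.
pose b := (#[g]%g)%:R^-1 *: S.
have q0 : 0 < #[g]%g%:R :> R[i] by rewrite ltr0n order_gt0.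
have sb : finite_stage iota phi Z0 J0 b.
  have algS : is_subalgebra (finite_stage iota phi Z0 J0) := generated_subalgebraP _.
  have [_ _ SZ _] := algS; apply: (SZ); apply: (subalgebra_sum algS) => i _.
  by apply: SZ; apply: (finite_stage_shift bern _ su) => z; apply: Z0_inv.
have ab : alpha g b = omega^-1 *: b.
  have o0 : omega != 0.
    by apply: contra_eqN oq => /eqP ->; rewrite expr0n gtn_eqF ?order_gt0 // eq_sym oner_eq0.
  have Sg : omega *: alpha g S = S by apply: cyclic_average.
  rewrite /b (star_homZ (ah g)) -[in RHS]Sg !scalerA.
  by rewrite mulrAC mulVf // mul1r.
have vb : `|v - b| <= 2^-1.
  have -> : v - b = (#[g]%g)%:R^-1 *: \sum_(i < #[g]%g) (v - omega ^+ i *: alpha (g ^+ i)%g u).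
    rewrite sumrB sumr_const card_ord scalerBr -[v *+ _]scaler_nat scalerA mulVf ?scale1r //.
    exact: lt0r_neq0.
  rewrite normrZ ger0_norm ?invr_ge0 ?ler0n // ler_pdivrMl // .
  apply: le_trans (ler_norm_sum _ _ _) _.
  apply: le_trans (_ : \sum_(i < #[g]%g) 2^-1 <= _); last by rewrite sumr_const card_ord mulr_natl.
  apply: ler_sum => i _; apply: le_trans (ler_distD (omega ^+ i *: alpha (g ^+ i)%g v) _ _) _.
  have -> : 2^-1 = 4^-1 + 4^-1 :> R[i].
    by rewrite [LHS]splitr -invfM -natrM.
  rewrite lerD //; first by rewrite distrC.
  rewrite -scalerBr -(star_homB (ah _)) normrZ normrX no expr1n mul1r.
  apply: le_trans (star_hom_bounded (ah _) _) _.
  have -> : 4^-1 = 2 * 8^-1 :> R[i].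
    by rewrite (_ : 8 = 2 * 4) ?invfM ?mulrA ?mulfV ?mul1r // -natrM.
  by rewrite ler_wpM2l // ltW.
have [w bw wb] := invertible_near_unitary sv vs vb.
have := finite_stage_eigenvalue actP Tt bern phiP Z0_inv sb ab bw wb.
by move/eqP; rewrite invr_eq1 (negPf o1).
Qed.
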